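(* Let $q$ be a prime power, let $n\ge 0$ be an integer, let $r,s$ be positive integers, and let $C(x)\in\mathbb{F}_{q^2}[x]$ be a self-conjugate reciprocal (SCR) polynomial of degree $n$. Let $B(x)\in\mathbb{F}_{q^2}[x]$ be such that $B(x)$ has no root in $\mu_{q+1}$ and the map $x\mapsto x^{r}B^{(q)}(1/x)/B(x)$ permutes $\mu_{q+1}$. Suppose $s\equiv r+n \pmod{q+1}$. Then $x^{s}B(x^{q-1})C(x^{q-1})$ permutes $\mathbb{F}_{q^2}$ if and only if $\gcd(s,q-1)=1$ and $C(x)$ has no root in $\mu_{q+1}$.
   Context: $\mu_{q+1}$ denotes the set of $(q+1)$-th roots of unity in $\mathbb{F}_{q^2}$. For $B(x)\in\mathbb{F}_{q^2}[x]$, $B^{(q)}(x)$ denotes the polynomial obtained from $B(x)$ by raising every coefficient to the $q$-th power. A nonzero polynomial $C(x)\in\mathbb{F}_{q^2}[x]$ of degree $n$ is self-conjugate reciprocal (SCR) if $x^{n}C^{(q)}(1/x)=\beta C(x)$ for some $\beta\in\mathbb{F}_{q^2}$. A polynomial permutes a finite set if it induces a bijection of that set onto itself. *)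

(* Defs.v *)
From mathcomp Require Import all_boot all_algebra.

Set Implicit Arguments.
Unset Strict Implicit.
Unset Printing Implicit Defensive.

Import GRing.Theory.
Local Open Scope ring_scope.

Definition prime_power (q : nat) : Prop :=
  exists p k : nat, [/\ prime p, (0 < k)%N & q = (p ^ k)%N].

Definition permutes (T : finType) (f : T -> T) (A : {set T}) : Prop :=
  [/\ {in A, forall x, f x \in A},
      {in A &, injective f}
    & {in A, forall y, exists2 x, x \in A & f x = y}].

Definition poly_permutes (F : finFieldType) (P : {poly F}) (A : {set F}) :
  Prop := permutes (fun x => P.[x]) A.

Definition mu (F : finFieldType) (m : nat) : {set F} :=
  [set x : F | m.-unity_root x].

Definition no_root_in (F : finFieldType) (P : {poly F}) (A : {set F}) : Prop :=
  {in A, forall x, ~~ root P x}.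

(* B^(q) *)
Definition conj_poly (F : finFieldType) (q : nat) (B : {poly F}) : {poly F} :=
  map_poly (fun a => a ^+ q) B.

(* The polynomial x^n P(1/x), for P of degree at most n; recip_polyE below
   checks this identity in the field of rational functions F(x). *)
Definition recip_poly (F : fieldType) (n : nat) (P : {poly F}) : {poly F} :=
  \poly_(i < n.+1) P`_(n - i).

Local Notation tofrac := (@FracField.tofrac _).

Lemma recip_polyE (F : fieldType) (n : nat) (P : {poly F}) :
  (size P <= n.+1)%N ->
  tofrac (recip_poly n P) =
    (tofrac 'X) ^+ n *
      (map_poly (fun a : F => tofrac a%:P) P).[(tofrac 'X)^-1].
Proof.
move=> sP.
have X0 : tofrac ('X : {poly F}) != 0 by rewrite tofrac_eq0 polyX_eq0.
rewrite (@horner_coef_wide _ n.+1); last exact: leq_trans (size_poly _ _) sP.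
rewrite mulr_sumr (reindex_inj rev_ord_inj) /= /recip_poly poly_def rmorph_sum /=.
apply: eq_bigr => i _; have lein : (i <= n)%N by rewrite -ltnS.
rewrite subSS coef_map_id0 ?polyC0 ?tofrac0 // -mul_polyC rmorphM rmorphXn /=.
rewrite mulrCA; congr (_ * _).
by rewrite exprVn -[in X in _ = X / _](subnK (leq_subr i n)) subKn // exprD
           mulrK // unitfE expf_neq0.
Qed.

Definition SCR (F : finFieldType) (q : nat) (C : {poly F}) : Prop :=
  C != 0 /\
  exists beta : F, recip_poly (size C).-1 (conj_poly q C) = beta *: C.

(* Main.v *)
(**
Write [P] for the polynomial and, for [x != 0], put [z = x^(q-1)], an element
of [mu_(q+1)].  On [mu_(q+1)] the [q]-th power map is inversion, so
[B(z)^q = B^(q)(1/z)], while the SCR identity gives [C(z)^q = beta z^(-n) C(z)].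
Since [z^s = z^(r+n)], if [C(z) != 0] then
[P(x)^(q-1) = beta * (z^r B^(q)(1/z) / B(z))].  As the second factor permutes
[mu_(q+1)], the value [P(x)] determines [z], hence [x^s] as well, hence [x] when
[s] is prime to [q-1].  Conversely a root of [C] in [mu_(q+1)] gives a nonzero
root of [P], and a primitive [gcd(s, q-1)]-th root of unity has the same image
under [P] as [1].
*)
Require Import Defs.
From mathcomp Require Import all_boot all_algebra.
From mathcomp Require Import cyclic finfield ring.

Set Implicit Arguments.
Unset Strict Implicit.
Unset Printing Implicit Defensive.

Import GRing.Theory.
Local Open Scope ring_scope.

(** As [q] is a power of the characteristic, [y ^+ q] is additive, so it passes through the sum of
    monomials. *)
Lemma horner_conj_poly (F : finFieldType) (q : nat) (P : {poly F}) (x : F) :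
  (0 < q)%N -> [pchar F].-nat q -> (conj_poly q P).[x ^+ q] = P.[x] ^+ q.
Proof.
move=> q0 qp; have zq : (0 : F) ^+ q = 0 by rewrite expr0n gtn_eqF.
rewrite (@horner_coef_wide _ (size P)) ?size_poly // horner_coef.
rewrite (big_morph (fun y : F => y ^+ q) (fun x y => exprDn_pchar x y qp) zq) /=.
by apply: eq_bigr => i _; rewrite coef_map_id0 // exprMn -!exprM mulnC.
Qed.

Lemma horner_recip_poly (F : fieldType) (n : nat) (P : {poly F}) (x : F) :
  (size P <= n.+1)%N -> x != 0 -> (recip_poly n P).[x] = x ^+ n * P.[x^-1].
Proof.
move=> sP x0; rewrite horner_poly (horner_coef_wide _ sP) mulr_sumr.
rewrite (reindex_inj rev_ord_inj) /=.
apply: eq_bigr => i _; have lein : (i <= n)%N by rewrite -ltnS.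
by rewrite subSS subKn // mulrCA exprVn exprB ?unitfE.
Qed.

Lemma finField_prim_root (F : finFieldType) :
  exists g : F, (#|F|.-1).-primitive_root g.
Proof.
have F0 : (0 < #|F|)%N by apply/card_gt0P; exists 0.
have F1 : (0 < #|F|.-1)%N by rewrite -ltnS prednK ?finNzRing_gt1.
have unitF (x : F) : x != 0 -> x ^+ #|F|.-1 = 1.
  by move=> x0; apply: (mulfI x0); rewrite -exprS prednK // expf_card mulr1.
have /hasP[g _ gP] : has (#|F|.-1).-primitive_root (enum (predC1 (0 : F))).
  apply: has_prim_root; rewrite ?enum_uniq // -?cardE ?cardC1 //.
  by apply/allP => x; rewrite mem_enum => x0; apply/unity_rootP/unitF.
by exists g.
Qed.

(** Writing [z = g ^+ i], the relation [z ^+ b = 1] forces [a * b] to divide [i * b], so [a] divides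
    [i]. With [a = q - 1] and [b = q + 1], every element of [mu F q.+1] is a [(q - 1)]-th power. *)
Lemma unity_root_expP (F : fieldType) (a b : nat) (g z : F) :
  (0 < b)%N -> (a * b).-primitive_root g -> z ^+ b = 1 ->
  exists2 x, x != 0 & x ^+ a = z.
Proof.
move=> b0 gP zb.
have zab : z ^+ (a * b) = 1 by rewrite mulnC exprM zb expr1n.
have [i zi] := prim_rootP gP zab.
have /dvdnP[k ik] : (a %| i)%N.
  by rewrite -(dvdn_pmul2r b0) (prim_order_dvd gP) exprM -zi zb.
exists (g ^+ k); last by rewrite -exprM -ik zi.
by rewrite expf_neq0 // (prim_root_eq0 gP) -lt0n (prim_order_gt0 gP).
Qed.

(** The quotient [x / y] is killed by both exponents, hence by their gcd, thanks to a Bezout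
    relation. *)
Lemma expf_coprime_inj (F : fieldType) (a b : nat) (x y : F) :
  (0 < a)%N -> coprime a b -> y != 0 -> x ^+ a = y ^+ a -> x ^+ b = y ^+ b ->
  x = y.
Proof.
move=> a0 /eqP ab y0 xya xyb.
have E (c : nat) : x ^+ c = y ^+ c -> (x / y) ^+ c = 1.
  by move=> xyc; rewrite exprMn exprVn xyc mulfV // expf_neq0.
case: (egcdnP b a0) => u v uv _.
suff xy1 : x / y = 1 by rewrite -[x](divfK y0) xy1 mul1r.
have := congr1 (fun m => (x / y) ^+ m) uv.
by rewrite ab exprD expr1 (mulnC u) (mulnC v) !exprM !E // !expr1n mul1r.
Qed.

Lemma expf_eq1_neq0 (F : fieldType) (m : nat) (z : F) :
  z ^+ m.+1 = 1 -> z != 0.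
Proof. by apply: contra_eq_neq => ->; rewrite expr0n /= eq_sym oner_eq0. Qed.

Lemma horner_mu_expf (F : finFieldType) (q : nat) (P : {poly F}) (z : F) :
  (0 < q)%N -> [pchar F].-nat q -> z ^+ q.+1 = 1 ->
  P.[z] ^+ q = (conj_poly q P).[z^-1].
Proof.
move=> q0 qp zq; rewrite -horner_conj_poly //; congr _.[_].
have z0 := expf_eq1_neq0 zq; by apply: (mulfI z0); rewrite -exprS zq divff.
Qed.

(** The SCR identity is evaluated at [z], where [z^-1] equals [z ^+ q]. *)
Lemma SCR_mu_expf (F : finFieldType) (q n : nat) (C : {poly F}) (beta z : F) :
  (0 < q)%N -> [pchar F].-nat q -> size C = n.+1 ->
  recip_poly n (conj_poly q C) = beta *: C -> z ^+ q.+1 = 1 ->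
  z ^+ n * C.[z] ^+ q = beta * C.[z].
Proof.
move=> q0 qp sC rC zq; rewrite (horner_mu_expf _ q0 qp zq) -(hornerZ beta) -rC.
rewrite horner_recip_poly //; first by rewrite -sC size_poly.
exact: expf_eq1_neq0 zq.
Qed.

Theorem theorem3p2 (q : nat) (hq : prime_power q)
  (F : finFieldType) (hF : #|F| = (q ^ 2)%N)
  (n r s : nat) (hr : (0 < r)%N) (hs : (0 < s)%N)
  (C : {poly F}) (hCdeg : size C = n.+1) (hC : SCR q C)
  (B : {poly F}) (hB : no_root_in B (mu F q.+1))
  (hperm : permutes (fun x : F => x ^+ r * (conj_poly q B).[x^-1] / B.[x])
             (mu F q.+1))
  (hsrn : s = (r + n)%N %[mod q.+1]) :
  poly_permutes ('X^s * (B \Po 'X^(q - 1)) * (C \Po 'X^(q - 1))) [set: F]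
  <->
  (gcdn s (q - 1) = 1%N /\ no_root_in C (mu F q.+1)).
Proof.
have [p [k [p_pr k0 qE]]] := hq.
have q0 : (0 < q)%N by rewrite qE expn_gt0 prime_gt0.
have pF : p \in [pchar F].
  by apply: (card_finPcharP (n := (k * 2)%N)) => //; rewrite hF qE expnM.
have qp : [pchar F].-nat q by rewrite qE pnatX pnatE // pF.
have cF : (#|F|.-1 = (q - 1) * q.+1)%N.
  by rewrite hF -subn1 -[1%N in LHS](exp1n 2) subn_sqr addn1.
have [g] := finField_prim_root F; rewrite cF => gP.
have muE (z : F) : (z \in mu F q.+1) = (z ^+ q.+1 == 1).
  by rewrite inE; apply/unity_rootP/eqP.
have expq1 (x : F) : x ^+ q = x * x ^+ (q - 1).
  by rewrite -exprS subn1 prednK.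
have mu_exp (x : F) : x != 0 -> (x ^+ (q - 1)) ^+ q.+1 = 1.
  move=> x0; apply: (mulfI x0); rewrite -exprM -cF -exprS prednK ?expf_card ?mulr1 //.
  by rewrite hF expn_gt0 q0.
case: hC => C0 [beta]; rewrite hCdeg /= => hbeta.
set P := (X in poly_permutes X).
have PE (x : F) : P.[x] = x ^+ s * B.[x ^+ (q - 1)] * C.[x ^+ (q - 1)].
  by rewrite /P !hornerM !horner_comp !hornerXn.
split=> [[_ Pinj _]|[sq hC]].
- split.
    (* The gcd divides the order of [g], so a power [u] of [g] has exactly this order. *)
    have dq : (gcdn s (q - 1) %| (q - 1) * q.+1)%N by rewrite dvdn_mulr ?dvdn_gcdr.
    have := dvdn_prim_root gP dq; set u := g ^+ _ => uP.
    have ueq0 m : (gcdn s (q - 1) %| m)%N -> u ^+ m = 1 by rewrite (prim_order_dvd uP) => /eqP.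
    have u1 : u = 1.
      apply: Pinj; rewrite ?inE // !PE !ueq0 ?dvdn_gcdl ?dvdn_gcdr //.
      by rewrite !expr1n.
    (* Since [u = 1], its order, which is the gcd, divides 1. *)
    by have := prim_order_dvd uP 1; rewrite expr1 u1 eqxx dvdn1 => /eqP.
  move=> z; rewrite muE => /eqP zq; apply/negP => /rootP Cz.
  have [x x0 xz] := unity_root_expP (ltn0Sn q) gP zq.
  (* [P] vanishes at [x] and also at 0, because [s] is positive. *)
  case/eqP: x0; apply: Pinj; rewrite ?inE // !PE xz Cz mulr0.
  by rewrite expr0n gtn_eqF // !mul0r.
have C_n0 z : z ^+ q.+1 = 1 -> C.[z] != 0.
  by move=> zq; apply: hC; rewrite muE zq.
have B_n0 z : z ^+ q.+1 = 1 -> B.[z] != 0.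
  by move=> zq; apply: hB; rewrite muE zq.
have beta0 : beta != 0.
  (* At [z = 1] the identity reads [C(1)^q = beta * C(1)], and [C(1)] is nonzero. *)
  have := SCR_mu_expf q0 qp hCdeg hbeta (expr1n _ q.+1).
  rewrite expr1n mul1r; apply: contra_eq_neq => ->.
  by rewrite mul0r expf_neq0 // C_n0 ?expr1n.
have P0 : P.[0] = 0 by rewrite PE expr0n gtn_eqF // !mul0r.
have P_n0 x : x != 0 -> P.[x] != 0.
  move=> x0; rewrite PE !mulf_neq0 ?expf_neq0 //.
    exact/B_n0/mu_exp.
  exact/C_n0/mu_exp.
pose f z := z ^+ r * (conj_poly q B).[z^-1] / B.[z].
have Pexp x : x != 0 -> P.[x] ^+ (q - 1) = beta * f (x ^+ (q - 1)).
  move=> x0; have := mu_exp x x0; have := PE x.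
  rewrite -[x ^+ s * _ * _]mulrA; set z := x ^+ (q - 1) => Px zq.
  have z0 : z != 0 by rewrite expf_neq0.
  have zs : z ^+ s = z ^+ r * z ^+ n.
    by rewrite -exprD -(expr_mod s zq) hsrn expr_mod.
  (* Multiplying by [P(x)] turns the exponent [q - 1] into [q]; then [x^(sq)] splits as
     [x^s * z^s]. *)
  apply: (mulfI (P_n0 x x0)); rewrite -expq1 Px !exprMn.
  rewrite -exprM mulnC exprM expq1 exprMn -/z zs.
  have Cq := SCR_mu_expf q0 qp hCdeg hbeta zq.
  rewrite /f -(horner_mu_expf _ q0 qp zq).
  transitivity (x ^+ s * (z ^+ r * (B.[z] ^+ q * (z ^+ n * C.[z] ^+ q)))).
    by ring.
  by rewrite Cq; field; apply: B_n0.
have Pinj : injective (fun x => P.[x]).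
  move=> x y; have [->|x0] := eqVneq x 0; have [->|y0] := eqVneq y 0 => //=.
  - by move/eqP; rewrite P0 eq_sym (negPf (P_n0 _ y0)).
  - by move/eqP; rewrite P0 (negPf (P_n0 _ x0)).
  move=> Pxy; have := Pexp x x0; rewrite Pxy Pexp // => /(mulfI beta0) fyx.
  have yx : y ^+ (q - 1) = x ^+ (q - 1).
    by case: hperm => _ finj _; apply: finj; rewrite ?muE ?mu_exp.
  (* The [(q - 1)]-th powers agree, so the nonzero factors [B(z)] and [C(z)] cancel and the [s]-th
     powers agree too. *)
  apply: (expf_coprime_inj hs _ y0 _ (esym yx)); first exact/eqP.
  move: Pxy; rewrite !PE yx.
  by move/(mulIf (C_n0 _ (mu_exp x x0)))/(mulIf (B_n0 _ (mu_exp x x0))).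
(* On a finite field injectivity already gives surjectivity. *)
split=> [x _|x y _ _|y _]; rewrite ?inE //; first exact: Pinj.
by have [h _ hK] := injF_bij Pinj; exists (h y); rewrite ?inE ?hK.
Qed.
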